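(* The truncated cuboctahedron is not orthogonally decomposable.
   Context: A polygonal path in $\mathbb{R}^3$ is orthogonal if each of its edges is parallel to one of the coordinate axes. A set $S\subset\mathbb{R}^3$ is orthogonally connected if any two distinct points of $S$ are joined by an orthogonal path contained in $S$. A polytope is decomposed into polytopes $P_1,\dots,P_k$ if it is their union and their interiors are pairwise disjoint. A polytope in $\mathbb{R}^3$ is orthogonally decomposable if it can be decomposed into finitely many polytopes with orthogonally connected boundaries. By convention a suitable rotation is allowed: $P$ is orthogonally decomposable if some rotated copy of $P$ has such a decomposition, and not orthogonally decomposable if no rotated copy of $P$ has one. The truncated cuboctahedron is the Archimedean solid with vertex configuration $4.6.8$; up to similarity it is the convex hull of all permutations of $(\pm1,\pm(1+\sqrt2),\pm(1+2\sqrt2))$. *)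

(* Defs.v *)
From HB Require Import structures.
From mathcomp Require Import all_boot all_order all_algebra all_fingroup.
From mathcomp Require Import all_classical all_reals all_analysis.

Set Implicit Arguments.
Unset Strict Implicit.
Unset Printing Implicit Defensive.

Import Order.TTheory GRing.Theory Num.Theory.
Import numFieldNormedType.Exports.

Local Open Scope classical_set_scope.
Local Open Scope ring_scope.

(* Points of R^3 are row vectors, so matrices act on the right. The topology is
   the one MathComp-Analysis puts on matrices; it comes from the sup norm and
   is therefore the Euclidean one. *)

Section OrthogonalDecompositions.
Context {R : realType}.
Local Notation E := 'rV[R]_3.
Implicit Types (A S P V : set E) (x y : E).

Definition segment x y : set E :=
  [set (1 - t) *: x + t *: y | t in `[0, 1]%classic].

Definition convex_hull A : set E := smallest (@convex_set R E) A.

(* Polytopes of dimension less than 3 are included. They never matter for the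
   decomposability of a polytope with nonempty interior: discarding them from a
   decomposition leaves a decomposition. *)
Definition polytope P : Prop :=
  exists2 V : set E, finite_set V & P = convex_hull V.

Definition boundary A : set E := closure A `\` interior A.

Definition axis_parallel x y : Prop :=
  exists (i : 'I_3) (c : R), c != 0 /\ y = x + c *: delta_mx 0 i.

(* [x :: s] is the sequence of vertices of the path. *)
Definition orthogonal_path_in S x (s : seq E) : Prop :=
  path (fun u v => `[< axis_parallel u v /\ segment u v `<=` S >]) x s.

Definition orthogonally_connected S : Prop :=
  forall x y, S x -> S y -> x <> y ->
    exists2 s : seq E, orthogonal_path_in S x s & last x s = y.

Definition decomposed_into P (k : nat) (p : 'I_k -> set E) : Prop :=
  [/\ forall i, polytope (p i),
      P = \bigcup_(i in [set: 'I_k]) p i &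
      forall i j, i != j -> interior (p i) `&` interior (p j) = set0].

Definition orthogonal_mx (Q : 'M[R]_3) : Prop := Q *m Q^T = 1%:M.

Definition rotation_mx (Q : 'M[R]_3) : Prop := orthogonal_mx Q /\ \det Q = 1.

(* Only rotations about the origin are needed: translations preserve both
   decompositions and orthogonal connectedness. *)
Definition orthogonally_decomposable P : Prop :=
  exists2 Q : 'M[R]_3, rotation_mx Q &
  exists (k : nat) (p : 'I_k -> set E),
    decomposed_into [set x *m Q | x in P] p /\
    forall i, orthogonally_connected (boundary (p i)).

Definition truncated_cuboctahedron_coord (i : 'I_3) : R :=
  nth 0 [:: 1; 1 + Num.sqrt 2; 1 + 2 * Num.sqrt 2] i.

Definition truncated_cuboctahedron_vertices : set E :=
  [set x | exists (s : 'S_3) (e : 'I_3 -> bool),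
     x = \row_i ((-1) ^+ e i * truncated_cuboctahedron_coord (s i))].

Definition is_truncated_cuboctahedron P : Prop :=
  exists (a : R) (Q : 'M[R]_3) (t : E),
    [/\ 0 < a, orthogonal_mx Q &
        P = [set a *: (x *m Q) + t
            | x in convex_hull truncated_cuboctahedron_vertices]].

End OrthogonalDecompositions.

(* Main.v *)
Require Import Defs.
From mathcomp Require Import all_boot all_order all_algebra.
From mathcomp Require Import all_classical all_reals all_analysis.
From mathcomp Require Import all_fingroup ring lra.

Set Implicit Arguments.
Unset Strict Implicit.
Unset Printing Implicit Defensive.

Import Order.TTheory GRing.Theory Num.Theory.
Import numFieldNormedType.Exports.

Local Open Scope classical_set_scope.
Local Open Scope ring_scope.

(** The obstruction is local, at a facet, and then combinatorial.

    Local part. Let [n] be the inward normal of a facet of a solid [B] that is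
    decomposed into finitely many convex pieces. Some piece has a point [x] on
    that facet around which it coincides with the half-space bounded by the
    plane of the facet, so that near [x] its boundary is that plane
    ([piece_fills_halfspace]). If the boundary of this piece is orthogonally
    connected, an axis-parallel segment must leave [x] within it; the segment
    can go neither out of the half-space nor, because the piece fills the
    half-space, into it. So it stays in the plane, which is therefore parallel
    to a coordinate axis: [n] has a zero coordinate ([filled_axis],
    [facet_normal_zero_coord]).

    Combinatorial part. The three axes of the rotated frame would thus be three
    nonzero vectors such that every facet normal of the truncated cuboctahedron
    is orthogonal to one of them. The hexagons and the squares alone, up to
    sign, supply ten normals: the four (1, +-1, +-1) and the six permutations
    of (1, +-1, 0). A nonzero vector is orthogonal to at most three of these
    ten ([orthogonal_normals_le3]), so three vectors account for at most nine.

    Two facets, one hexagon and one square, are examined explicitly;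
    the other eight are their images under signed permutations of the
    coordinates ([hull_facet_normals]). *)

(** * Convex sets and linear heights *)

Section Convexity.
Context {R : realType}.
Local Notation E := 'rV[R]_3.
Implicit Types (A C S V : set E) (x y : E).

Lemma convex_setP A :
  convex_set A <-> forall x y (s t : R), 0 <= s -> 0 <= t -> s + t = 1 ->
                     A x -> A y -> A (s *: x + t *: y).
Proof.
split=> [cA x y s t s0 t0 st Ax Ay|cA x y l /set_mem Ax /set_mem Ay].
  have s1 : s <= 1 by rewrite -st lerDl.
  have := cA x y (Itv01 s0 s1) (mem_set Ax) (mem_set Ay).
  by move=> /set_mem; rewrite /conv/= /unstable.onem -st addrAC subrr add0r.
apply: mem_set; apply: cA => //.
- by rewrite /unstable.onem subr_ge0.
- by rewrite /unstable.onem addrC subrK.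
Qed.

Lemma convex_comb3 A (x y z : E) (s t u : R) : convex_set A ->
  0 < s -> 0 < t -> 0 < u -> s + t + u = 1 -> A x -> A y -> A z ->
  A (s *: x + t *: y + u *: z).
Proof.
move=> /convex_setP cA s0 t0 u0 stu Ax Ay Az.
have st0 : 0 < s + t by rewrite addr_gt0.
have -> : s *: x + t *: y =
    (s + t) *: ((s / (s + t)) *: x + (t / (s + t)) *: y).
  by rewrite scalerDr !scalerA !(mulrC (s + t)) !divfK ?gt_eqF.
apply: (cA); rewrite ?ltW //.
by apply: cA; rewrite ?divr_ge0 ?ltW // -mulrDl divff // gt_eqF.
Qed.

Lemma convex_comb4 A (x y z w : E) (s t u v : R) : convex_set A ->
  0 < s -> 0 < t -> 0 < u -> 0 < v -> s + t + u + v = 1 ->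
  A x -> A y -> A z -> A w ->
  A (s *: x + t *: y + u *: z + v *: w).
Proof.
move=> cA s0 t0 u0 v0 stuv Ax Ay Az Aw.
have st0 : 0 < s + t by rewrite addr_gt0.
have -> : s *: x + t *: y =
    (s + t) *: ((s / (s + t)) *: x + (t / (s + t)) *: y).
  by rewrite scalerDr !scalerA !(mulrC (s + t)) !divfK ?gt_eqF.
apply: convex_comb3 => //; move/convex_setP: cA; apply => //.
- by rewrite divr_ge0 ?ltW.
- by rewrite divr_ge0 ?ltW.
- by rewrite -mulrDl divff // gt_eqF.
Qed.

Lemma sub_convex_hull V : V `<=` convex_hull V.
Proof. exact: sub_gen_smallest. Qed.

Lemma convex_hull_sub V A : convex_set A -> V `<=` A -> convex_hull V `<=` A.
Proof. exact: smallest_sub. Qed.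

Lemma convex_hull_convex V : convex_set (convex_hull V).
Proof.
apply/convex_setP => x y s t s0 t0 st Vx Vy A [cA VA].
by move/convex_setP: (cA); apply => //; [apply: Vx|apply: Vy].
Qed.

Lemma polytope_convex A : polytope A -> convex_set A.
Proof. by case=> V _ ->; exact: convex_hull_convex. Qed.

Definition height (n : 'cV[R]_3) x : R := (x *m n) 0 0.

Lemma heightD n x y : height n (x + y) = height n x + height n y.
Proof. by rewrite /height mulmxDl mxE. Qed.

Lemma heightZ n a x : height n (a *: x) = a * height n x.
Proof. by rewrite /height -scalemxAl mxE. Qed.

Lemma heightB n x y : height n (x - y) = height n x - height n y.
Proof. by rewrite heightD -scaleN1r heightZ mulN1r. Qed.

Lemma height_continuous n : continuous (height n).
Proof.
have sum3 (T : topologicalType) (f g h : T -> R) : continuous f ->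
    continuous g -> continuous h -> continuous (fun p => f p + g p + h p).
  move=> cf cg ch p.
  by apply: cvgD; [apply: cvgD; [exact: cf|exact: cg]|exact: ch].
have coord j : continuous (fun y : E => y 0 j * n j 0).
  move=> y.
  by apply: continuousM; [exact: coord_continuous|exact: cst_continuous].
pose i1 : 'I_3 := lift ord0 ord0; pose i2 : 'I_3 := lift ord0 (lift ord0 ord0).
have -> : height n =
    (fun y => y 0 ord0 * n ord0 0 + y 0 i1 * n i1 0 + y 0 i2 * n i2 0).
  by apply/funext => y; rewrite /height mxE !big_ord_recl big_ord0 addr0 addrA.
exact: sum3.
Qed.

Lemma height_delta n j : height n (delta_mx 0 j) = n j 0.
Proof. by rewrite /height -rowE mxE. Qed.

Lemma convex_halfspace n (h : R) : convex_set [set x : E | h <= height n x].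
Proof.
apply/convex_setP => x y s t s0 t0 st /= hx hy.
have -> : h = s * h + t * h by rewrite -mulrDl st mul1r.
by rewrite heightD !heightZ; apply: lerD; exact: ler_wpM2l.
Qed.

End Convexity.

(** * Boundary points where a set fills a half-space *)

Section FlatPoints.
Context {R : realType}.
Local Notation E := 'rV[R]_3.
Implicit Types (C U : set E) (x y d : E) (n : 'cV[R]_3).

Lemma nbhs_ray x d U : nbhs x U ->
  exists2 e : R, 0 < e & forall t, `|t| < e -> U (x + t *: d).
Proof.
move=> Ux.
have cv : (fun t : R => x + t *: d) @ (0 : R) --> x.
  rewrite -[X in _ --> X]addr0 -[X in x + X](scale0r d).
  by apply: cvgD; [exact: cvg_cst|exact: cvgZr_tmp].
have /nbhs_ballP[e /= e0 eU] := cv _ Ux.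
exists e => // t te; apply: eU; rewrite /ball /=.
by rewrite sub0r normrN.
Qed.

Section FilledHalfspace.
Context (n : 'cV[R]_3) (C : set E) (h : R).
Hypothesis above : forall y, C y -> h <= height n y.

Lemma closure_above y : closure C y -> h <= height n y.
Proof.
move=> Cy; rewrite leNgt; apply/negP => yh.
have /Cy[z [/above zh /=]] : nbhs y [set z | height n z < h].
  exact: (cvgr_lt _ (@height_continuous _ n y)).
by rewrite ltNge zh.
Qed.

Lemma filled_boundary x d U : nbhs x U -> height n x = h -> 0 < height n d ->
  (forall y, U y -> h < height n y -> C y) -> boundary C x.
Proof.
move=> Ux xh d0 UC; split.
- move=> B /(filterI Ux) /(nbhs_ray d)[e e0 eUB].
  have [] := eUB (e / 2); first by rewrite ger0_norm; lra.
  move=> Uy By; exists (x + (e / 2) *: d); split=> //.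
  apply: UC => //; rewrite heightD heightZ xh ltrDl mulr_gt0 //; lra.
- move=> /(nbhs_ray d)[e e0 eC].
  have /above : C (x + (- (e / 2)) *: d).
    by apply: eC; rewrite normrN ger0_norm; lra.
  rewrite heightD heightZ xh.
  have : 0 < e / 2 * height n d by rewrite mulr_gt0 //; lra.
  by lra.
Qed.

(** Moving from the flat point [x] into the half-space enters the interior at
    once, so an axis-parallel path in the boundary cannot start that way. *)
Lemma filled_interior x d U : open U -> U x -> height n x = h ->
  0 < height n d -> (forall y, U y -> h < height n y -> C y) ->
  exists2 e : R, 0 < e & forall t, 0 < t < e -> interior C (x + t *: d).
Proof.
move=> oU Ux xh d0 UC.
have /(nbhs_ray d)[e e0 eU] : nbhs x U by exact: open_nbhs_nbhs.
exists e => // t /andP[t0 te].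
have Ut : U (x + t *: d) by apply: eU; rewrite gtr0_norm.
have : nbhs (x + t *: d) [set y | U y /\ h < height n y].
  apply: filterI; first exact: open_nbhs_nbhs.
  apply: (cvgr_gt _ (@height_continuous _ n _)).
  by rewrite heightD heightZ xh ltrDl mulr_gt0.
by apply: filterS => y [Uy hy]; exact: UC.
Qed.

(** Flatness forces an axis direction into the plane [height n = h]: the first
    edge of a boundary path from [x] can neither descend, since the closure of
    [C] stays above [h], nor ascend, by [filled_interior]. A second boundary
    point, needed for such a path to exist, is found on the plane near [x]. *)
Lemma filled_axis x U : orthogonally_connected (boundary C) ->
  open U -> U x -> height n x = h ->
  (forall y, U y -> h < height n y -> C y) -> exists j, n j 0 = 0.
Proof.
move=> conn oU Ux xh UC; apply: contrapT => /forallNP n0.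
have [d d0] : exists d, 0 < height n d.
  exists (n ord0 0 *: delta_mx 0 ord0).
  rewrite heightZ height_delta -expr2 lt0r sqr_ge0 sqrf_eq0 andbT.
  exact/eqP.
have bx : boundary C x.
  by apply: filled_boundary d0 UC => //; exact: open_nbhs_nbhs.
(* [v] is nonzero and tangent to the plane, and [x'] lies still in [U]. *)
pose i1 : 'I_3 := lift ord0 ord0.
pose v : E := n i1 0 *: delta_mx 0 ord0 - n ord0 0 *: delta_mx 0 i1.
have v0 : height n v = 0 by rewrite heightB !heightZ !height_delta mulrC subrr.
have [e e0 eU] := nbhs_ray v (open_nbhs_nbhs (conj oU Ux)).
pose x' := x + (e / 2) *: v.
have Ux' : U x' by apply: eU; rewrite ger0_norm; lra.
have bx' : boundary C x'.
  apply: filled_boundary d0 UC => //; first exact: open_nbhs_nbhs.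
  by rewrite heightD heightZ v0 mulr0 addr0.
have xx' : x <> x'.
  move=> /(congr1 (fun y : E => y 0 ord0)) /eqP.
  rewrite !mxE /= mulr1 mulr0 subr0 -subr_eq0 opprD addrA subrr sub0r.
  rewrite oppr_eq0 mulf_eq0 => /orP[/eqP|/eqP]; last exact: n0.
  by lra.
have [[|y s]] := conn _ _ bx bx' xx'; first by move=> _ /= /xx'.
rewrite /orthogonal_path_in /=.
move=> /andP[/asboolP[[j [c [c0 ->]]] seg] _] _.
have segt t : 0 <= t <= 1 -> boundary C (x + t *: (c *: delta_mx 0 j)).
  move=> t01; apply: seg; exists t; first by rewrite /= in_itv.
  by rewrite scalerDr addrA -scalerDl subrK scale1r.
have := n0 j; rewrite -height_delta => nj.
have [cj|cj|cj] := ltgtP 0 (height n (c *: delta_mx 0 j)).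
- have [e' e'0 e'C] := filled_interior oU Ux xh cj UC.
  pose t := Num.min 1 (e' / 2).
  have t0 : 0 < t by rewrite lt_min; apply/andP; split; lra.
  have t1 : t <= 1 by rewrite ge_min lexx.
  have te : t < e' by rewrite gt_min; apply/orP; right; lra.
  have [_] := segt t ltac:(by rewrite (ltW t0) t1).
  by apply; apply: e'C; rewrite t0.
- have [/closure_above + _] := segt 1 ltac:(by rewrite ler01 lexx).
  by rewrite scale1r heightD xh lerDl leNgt cj.
- move: cj; rewrite heightZ => /esym/eqP.
  by rewrite mulf_eq0 (negbTE c0) => /eqP.
Qed.

End FilledHalfspace.
End FlatPoints.

(** * A piece that fills a half-space at a facet *)

Lemma pigeonhole3 k (f : nat -> 'I_k) : exists m1 m2 m3 : nat,
  [/\ m1 != m2, m2 != m3 & m3 != m1] /\ f m1 = f m2 /\ f m2 = f m3.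
Proof.
pose g (m : 'I_(k.*2.+1)) := f m.
have [i] : exists i, (2 < #|[pred m | g m == i]|)%N.
  apply: contrapT => /forallNP le2.
  have : (#|'I_(k.*2.+1)| <= \sum_(i < k) 2)%N.
    rewrite -sum1_card (partition_big g xpredT) //=; apply: leq_sum => i _.
    by rewrite leqNgt; apply/negP; rewrite sum1_card; exact: le2.
  by rewrite card_ord sum_nat_const card_ord muln2 ltnn.
case/card_gt2P => m1 [m2 [m3 [[/eqP g1 /eqP g2 /eqP g3] [n12 n23 n31]]]].
exists m1, m2, m3; split; first by split; rewrite -val_eqE in n12 n23 n31.
by rewrite -/(g m1) -/(g m2) -/(g m3) g1 g2 g3.
Qed.

Section Facets.
Context {R : realType}.
Local Notation E := 'rV[R]_3.
Implicit Types (B S U : set E) (x y w : E) (n : 'cV[R]_3) (M : 'M[R]_3).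

Lemma sum_ord3 (V : nmodType) (f : 'I_3 -> V) : \sum_i f i = f 0 + f 1 + f 2.
Proof.
rewrite !big_ord_recl big_ord0 addr0 addrA.
by congr (f _ + f _ + f _); apply/val_inj.
Qed.

Lemma forall_ord3 (P : 'I_3 -> Prop) : P 0 -> P 1 -> P 2 -> forall i, P i.
Proof.
move=> P0 P1 P2 [[|[|[|//]]] lti].
- by have -> : Ordinal lti = 0 by apply/val_inj.
- by have -> : Ordinal lti = 1 by apply/val_inj.
- by have -> : Ordinal lti = 2 by apply/val_inj.
Qed.

Definition row3 (a b c : R) : E := \row_i nth 0 [:: a; b; c] i.

Lemma row3E a b c :
  (row3 a b c 0 0 = a) * (row3 a b c 0 1 = b) * (row3 a b c 0 2 = c).
Proof. by rewrite !mxE. Qed.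

Lemma row3P x : x = row3 (x 0 0) (x 0 1) (x 0 2).
Proof.
apply/rowP => i; move: i.
by apply: forall_ord3; rewrite row3E.
Qed.

(** [n] is the inward normal of a supporting plane on which [S] rests along a set
    of dimension 2. The witness is a tetrahedron with vertex [q], whose edges at
    [q] are the rows of [M] and whose interior lies in [S]: the equation
    [M *m n = _] puts the first two edges in the plane and makes the third point
    inwards. *)
Definition facet_normal S n := exists q M (kappa : R),
  [/\ M \in unitmx, 0 < kappa, M *m n = kappa *: delta_mx 2 0,
      forall x, S x -> height n q <= height n x &
      forall w, (forall j, 0 < w 0 j) -> w 0 0 + w 0 1 + w 0 2 < 1 ->
        S (q + w *m M)].

Lemma height_col j M x : height (col j M) x = (x *m M) 0 j.
Proof. by rewrite /height colE mulmxA -colE mxE. Qed.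

Lemma open_coord (f : E -> R) c : continuous f -> open [set y | c < f y].
Proof.
by move=> /continuousP cf; apply: (cf [set r | c < r]); exact: open_gt.
Qed.

(** The parabola [s |-> (s, s ^ 2)] is drawn on the facet, so that any three of
    its points are affinely independent. Above each of its points, some piece
    contains points arbitrarily close to the facet, hence by convexity a whole
    segment above it. Three points of the parabola share such a piece,
    which then contains a prism on the triangle that they span, and the
    centre of that triangle is the point wanted. Working with segments above
    the facet makes the pieces of dimension less than 3 harmless. *)
Lemma piece_fills_halfspace B n k (p : 'I_k -> set E) :
  facet_normal B n -> B = \bigcup_(i in [set: 'I_k]) p i ->
  (forall i, convex_set (p i)) ->
  exists i x U, [/\ open U, U x, forall y, B y -> height n x <= height n y &
    forall y, U y -> height n x < height n y -> p i y].
Proof.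
move=> [q [M [kappa [Munit kappa0 Mn above simplex]]]] Bp cp.
(* [W 0], [W 1], [W 2] are the affine coordinates of the tetrahedron, and
   [W 2] is proportional to the height above the facet. *)
pose W j y : R := ((y - q) *m invmx M) 0 j.
have WE j w : W j (q + w *m M) = w 0 j by rewrite /W addrC addKr mulmxK.
have coordE y : y = q + row3 (W 0 y) (W 1 y) (W 2 y) *m M.
  by rewrite -row3P mulmxKV // addrC subrK.
have hE (u v w : R) : height n (q + row3 u v w *m M) = height n q + w * kappa.
  rewrite heightD; congr (_ + _).
  rewrite /height -mulmxA Mn -scalemxAr mxE mxE sum_ord3 !row3E !mxE /=.
  by rewrite !mulr0 !add0r mulr1 mulrC.
pose pt (s t : R) := q + row3 s (s ^+ 2) t *m M.
have ptB s t : 0 < s < 1 / 2 -> 0 < t < 1 / 4 -> B (pt s t).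
  move=> /andP[s0 s1] /andP[t0 t1]; apply: simplex; last by rewrite !row3E; nra.
  by apply: forall_ord3; rewrite row3E // exprn_gt0.
have piece s : 0 < s < 1 / 2 -> exists i, exists2 e : R, 0 < e &
    forall t, 0 < t < e -> p i (pt s t).
  move=> s01.
  have [i near_i] : exists i, forall e, 0 < e ->
      exists2 t : R, 0 < t < e & p i (pt s t).
    apply: contrapT => /forallNP none.
    have /choice[e ne] i : exists e : R,
        0 < e /\ forall t, 0 < t < e -> ~ p i (pt s t).
      have /existsNP[e /not_implyP[e0 nt]] := none i.
      by exists e; split=> // t te pt'; apply: nt; exists t.
    pose t := (\big[Num.min/1 / 4]_i e i) / 2.
    have m0 : 0 < \big[Num.min/1 / 4 : R]_i e i.
      by apply: lt_bigmin => [|i _]; [lra|have [] := ne i].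
    have m1 : \big[Num.min/1 / 4 : R]_i e i <= 1 / 4 by exact: bigmin_le_id.
    have : B (pt s t) by apply: ptB => //; rewrite /t; lra.
    rewrite Bp => -[i _]; have [_] := ne i; apply.
    have := bigmin_le (1 / 4) i e; rewrite /t => mi.
    by apply/andP; split; lra.
  exists i; have [t1 /andP[t10 _] pt1] := near_i 1 ltr01.
  exists t1 => // t /andP[t0 tt1]; have [t2 /andP[t20 t2t] pt2] := near_i t t0.
  have d0 : 0 < t1 - t2 by lra.
  pose c := (t - t2) / (t1 - t2).
  have -> : pt s t = c *: pt s t1 + (1 - c) *: pt s t2.
    rewrite /pt !scalerDr addrACA -scalerDl (addrC c) subrK scale1r.
    congr (_ + _).
    rewrite !scalemxAl -mulmxDl; congr (_ *m _).
    rewrite [LHS]row3P [RHS]row3P !mxE /=.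
    by congr row3; rewrite /c; field; lra.
  move/convex_setP: (cp i); apply => //.
  - by rewrite divr_ge0 //; lra.
  - by rewrite subr_ge0 ler_pdivrMr // mul1r; lra.
  - by rewrite (addrC c) subrK.
(* Infinitely many parameters in ]0, 1/2[, where [s + s ^ 2 < 3 / 4]. *)
pose s (m : nat) : R := (m%:R + 3)^-1.
have s01 m : 0 < s m < 1 / 2.
  have m0 : (0 : R) <= m%:R by [].
  by rewrite invr_gt0 /s div1r ltf_pV2 ?posrE; lra.
have s_inj m m' : m != m' -> s m != s m'.
  by apply: contraNN => /eqP/invr_inj/addIr/eqP; rewrite eqr_nat.
have /choice[f fP] m := piece (s m) (s01 m).
have [m1 [m2 [m3 [[/s_inj n12 /s_inj n23 /s_inj n31] [f12 f23]]]]] :=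
  pigeonhole3 f.
have [e1 e10 P1] := fP m1; have [e2 e20 P2] := fP m2; have [e3 e30 P3] := fP m3.
rewrite f12 f23 in P1; rewrite f23 in P2.
move: (f m3) (s m1) (s m2) (s m3) n12 n23 n31 P1 P2 P3.
move=> i a b c ab bc ca Pa Pb Pc.
have d1 : (a - b) * (a - c) != 0 by rewrite mulf_neq0 // subr_eq0 // eq_sym.
have d2 : (b - a) * (b - c) != 0 by rewrite mulf_neq0 // subr_eq0 // eq_sym.
have d3 : (c - a) * (c - b) != 0 by rewrite mulf_neq0 // subr_eq0 // eq_sym.
(* The barycentric coordinates of the triangle with parameters [s], [t], [u]:
   on the parabola they are the Lagrange polynomials
   [(r - t) * (r - u) / ((s - t) * (s - u))]. *)
pose L (s t u : R) y : R :=
  (W 1 y - (t + u) * W 0 y + t * u) / ((s - t) * (s - u)).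
have Wcont j : continuous (W j).
  have -> : W j = (fun y =>
      height (col j (invmx M)) y + - height (col j (invmx M)) q).
    by apply/funext => y; rewrite -heightB height_col.
  have shift (T : topologicalType) (g : T -> R) (r : R) :
      continuous g -> continuous (fun p => g p + r).
    by move=> cg p'; apply: cvgD; [exact: cg|exact: cvg_cst].
  exact/shift/height_continuous.
have Lcont s' t u : continuous (L s' t u).
  have affine (T : topologicalType) (g g' : T -> R) (r r' r'' : R) :
      continuous g -> continuous g' ->
      continuous (fun p => (g p - r * g' p + r') / r'').
    move=> cg cg' p'; apply: cvgM; last exact: cvg_cst.
    apply: cvgD; last exact: cvg_cst.
    by apply: cvgB; [exact: cg|apply: cvgM; [exact: cvg_cst|exact: cg']].
  exact: affine.
pose e0 := Num.min e1 (Num.min e2 e3).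
have e00 : 0 < e0 by rewrite !lt_min e10 e20 e30.
pose U := [set y | 0 < L a b c y] `&` [set y | 0 < L b a c y] `&`
          [set y | 0 < L c a b y] `&` (W 2 @^-1` [set r | r < e0]).
pose x :=
  q + row3 ((a + b + c) / 3) ((a ^+ 2 + b ^+ 2 + c ^+ 2) / 3) 0 *m M.
have Wx : (W 0 x = (a + b + c) / 3)
    * (W 1 x = (a ^+ 2 + b ^+ 2 + c ^+ 2) / 3) * (W 2 x = 0).
  by rewrite !WE !row3E.
have hx : height n x = height n q by rewrite hE mul0r addr0.
exists i, x, U; split.
- apply: openI; first by apply: openI; [apply: openI|]; exact: open_coord.
  by move/continuousP: (Wcont 2); apply; exact: open_lt.
- have third (u v w : R) : (u - v) * (u - w) != 0 ->
      u + v + w = a + b + c ->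
      u ^+ 2 + v ^+ 2 + w ^+ 2 = a ^+ 2 + b ^+ 2 + c ^+ 2 -> 0 < L u v w x.
    rewrite mulf_eq0 negb_or => /andP[uv uw] e e'; rewrite /L !Wx -e -e'.
    by rewrite (_ : _ / _ = 1 / 3); [lra|field; rewrite uv uw].
  split; last by rewrite /= Wx.
  by split; [split|]; apply: third => //; ring.
- by move=> y; rewrite hx; exact: above.
- move=> y [[[/= La Lb] Lc] We].
  rewrite hx {1}(coordE y) hE ltrDl pmulr_lgt0 // => W0.
  have sum1 : L a b c y + L b a c y + L c a b y = 1.
    move: d1 d2 d3; rewrite !mulf_eq0 !negb_or /L.
    move=> /andP[? ?] /andP[? ?] /andP[? ?].
    by field; do ?[apply/andP; split].
  have {We} We : W 2 y < e0 by [].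
  move: We; rewrite /e0 !lt_min => /and3P[We1 We2 We3].
  have -> : y = L a b c y *: pt a (W 2 y) + L b a c y *: pt b (W 2 y)
              + L c a b y *: pt c (W 2 y).
    rewrite {1}[y]coordE /pt !scalerDr !scalemxAl.
    rewrite [_ *: q + _ + _]addrACA [X in _ = X]addrACA -!scalerDl sum1.
    rewrite scale1r -!mulmxDl; congr (_ + _ *m _).
    rewrite [RHS]row3P !mxE /=.
    move: d1 d2 d3 sum1; rewrite !mulf_eq0 !negb_or /L.
    move=> /andP[? ?] /andP[? ?] /andP[? ?] sum1.
    congr row3.
    - by field; do ?[apply/andP; split].
    - by field; do ?[apply/andP; split].
    - by rewrite -!mulrDl sum1 mul1r.
  by apply: (convex_comb3 (cp i)) => //;
    [apply: Pa|apply: Pb|apply: Pc]; rewrite W0.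
Qed.
End Facets.

(** * Ten normals and the vectors orthogonal to them *)

Section Count.
Context {R : realType}.
Local Notation E := 'rV[R]_3.

Lemma height_row3 (a b c : R) (x : E) :
  height (row3 a b c)^T x = x 0 0 * a + x 0 1 * b + x 0 2 * c.
Proof. by rewrite /height mxE sum_ord3 !mxE. Qed.

(** Up to sign, the normals of the hexagons and of the squares. *)
Definition facet_normals : seq 'cV[R]_3 :=
  [:: (row3 1 1 1)^T; (row3 1 1 (-1))^T; (row3 1 (-1) 1)^T;
      (row3 1 (-1) (-1))^T; (row3 1 1 0)^T; (row3 1 (-1) 0)^T; (row3 1 0 1)^T;
      (row3 1 0 (-1))^T; (row3 0 1 1)^T; (row3 0 1 (-1))^T].

(** The number of normals in [facet_normals] orthogonal to (x, y, z), spelled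
    out because its invariance under signed permutations then amounts to a
    reordering of the summands. *)
Definition vanishing_forms (x y z : R) : nat :=
  ((x + y + z == 0)%R + (x + y - z == 0)%R + (x - y + z == 0)%R
   + (x - y - z == 0)%R + (x + y == 0)%R + (x - y == 0)%R + (x + z == 0)%R
   + (x - z == 0)%R + (y + z == 0)%R + (y - z == 0)%R)%N.

Lemma addN_eq0 (x y : R) : (- x + y == 0) = (x - y == 0).
Proof. by rewrite -oppr_eq0 opprD opprK. Qed.

Lemma vanishing_formsN x y z :
  vanishing_forms (- x) y z = vanishing_forms x y z.
Proof.
rewrite /vanishing_forms -!(addrA (- x)) !addN_eq0 !opprD !opprK !addrA.
ring.
Qed.

Lemma vanishing_formsCl x y z : vanishing_forms y x z = vanishing_forms x y z.
Proof.
rewrite /vanishing_forms (addrC y x) (addrC y (- x)) -!(addrA (- x)) !addN_eq0.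
rewrite !opprD !opprK !addrA. ring.
Qed.

Lemma vanishing_formsCr x y z : vanishing_forms x z y = vanishing_forms x y z.
Proof.
rewrite /vanishing_forms !(addrAC x z) !(addrAC x (- z)) (addrC z y).
rewrite (addrC z (- y)) addN_eq0. ring.
Qed.

(** Once the signs and the order of the coordinates are fixed, four of the ten
    forms cannot vanish, and the vanishing of x - y + z, x + y or x + y - z
    excludes enough of the others; three forms are left if none of these
    vanishes. *)
Lemma vanishing_forms_sorted x y z : 0 <= x -> x <= y -> y <= z ->
  ~ (x = 0 /\ y = 0 /\ z = 0) -> (vanishing_forms x y z <= 3)%N.
Proof.
move=> x0 xy yz nz; have z0 : 0 < z.
  rewrite lt0r (le_trans x0) ?(le_trans xy) // andbT; apply/eqP => z0.
  by apply: nz; do ?split; lra.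
rewrite /vanishing_forms (gt_eqF (_ : 0 < x + y + z)); last by lra.
rewrite (lt_eqF (_ : x - y - z < 0)); last by lra.
rewrite (gt_eqF (_ : 0 < x + z)); last by lra.
rewrite (gt_eqF (_ : 0 < y + z)); last by lra.
have [y_xz|_] := eqVneq (x - y + z) 0.
  rewrite (gt_eqF (_ : 0 < x + y)); last by lra.
  rewrite (lt_eqF (_ : x - y < 0)); last by lra.
  rewrite (lt_eqF (_ : x - z < 0)); last by lra.
  by do 2 case: eqP => _.
have [xy0|_] := eqVneq (x + y) 0.
  rewrite (lt_eqF (_ : x + y - z < 0)); last by lra.
  rewrite (lt_eqF (_ : x - z < 0)); last by lra.
  rewrite (lt_eqF (_ : y - z < 0)); last by lra.
  by case: eqP.
have [z_xy|_] := eqVneq (x + y - z) 0; last by do 3 case: eqP => _.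
have [x_y|_] := eqVneq (x - y) 0; last by do 2 case: eqP => _.
by rewrite (lt_eqF (_ : x - z < 0)); [case: eqP|lra].
Qed.

(** A signed permutation makes the coordinates nonnegative and sorted. *)
Lemma vanishing_forms_le3 x y z :
  ~ (x = 0 /\ y = 0 /\ z = 0) -> (vanishing_forms x y z <= 3)%N.
Proof.
have abs1 a b c : vanishing_forms a b c = vanishing_forms `|a| b c.
  by case: (ger0P a); rewrite ?vanishing_formsN.
have -> : vanishing_forms x y z = vanishing_forms `|x| `|y| `|z|.
  rewrite abs1 -vanishing_formsCl abs1.
  rewrite -vanishing_formsCr -vanishing_formsCl abs1.
  by rewrite vanishing_formsCl vanishing_formsCr vanishing_formsCl.
have norm0 (a : R) : a = 0 <-> `|a| = 0.
  by split=> [->|/normr0_eq0 //]; rewrite normr0.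
rewrite (norm0 x) (norm0 y) (norm0 z).
move: `|x| `|y| `|z| (normr_ge0 x) (normr_ge0 y) (normr_ge0 z).
move=> {}x {}y {}z x0 y0 z0 nz.
have [xy|/ltW yx] := leP x y; have [yz|/ltW zy] := leP y z.
- exact: vanishing_forms_sorted.
- rewrite -vanishing_formsCr; have [xz|/ltW zx] := leP x z.
    by apply: vanishing_forms_sorted => //; tauto.
  by rewrite -vanishing_formsCl; apply: vanishing_forms_sorted => //; tauto.
- rewrite -vanishing_formsCl; have [xz|/ltW zx] := leP x z.
    by apply: vanishing_forms_sorted => //; tauto.
  by rewrite -vanishing_formsCr; apply: vanishing_forms_sorted => //; tauto.
- rewrite -vanishing_formsCr -vanishing_formsCl -vanishing_formsCr.
  by apply: vanishing_forms_sorted => //; tauto.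
Qed.

Lemma orthogonal_normals_le3 (u : E) : u != 0 ->
  (\sum_(n <- facet_normals) (height n u == 0)%R <= 3)%N.
Proof.
move=> u0; rewrite /facet_normals !big_cons big_nil !height_row3.
rewrite !mulr1 !mulr0 !mulrN1 !addr0 !add0r addn0 !addnA.
apply: vanishing_forms_le3 => -[x0 [y0 z0]]; case/eqP: u0.
by apply/rowP; apply: forall_ord3; rewrite mxE.
Qed.

End Count.

(** * Facet normals of decomposed solids and of convex hulls *)

Section Invariance.
Context {R : realType}.
Local Notation E := 'rV[R]_3.
Implicit Types (S V : set E) (x y : E) (n : 'cV[R]_3).

Lemma facet_normal_zero_coord S n k (p : 'I_k -> set E) :
  facet_normal S n -> decomposed_into S p ->
  (forall i, orthogonally_connected (boundary (p i))) -> exists j, n j 0 = 0.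
Proof.
move=> Sn [pp Sp _] conn.
have [i [x [U [oU Ux Sx fill]]]] :=
  piece_fills_halfspace Sn Sp (fun i => polytope_convex (pp i)).
apply: (@filled_axis _ n (p i) (height n x) _ x U) => // y py.
by apply: Sx; rewrite Sp; exists i.
Qed.

Lemma facet_normal_similarity S n (a : R) (Q : 'M[R]_3) (t : E) :
  0 < a -> orthogonal_mx Q -> facet_normal S n ->
  facet_normal [set a *: (x *m Q) + t | x in S] (Q^T *m n).
Proof.
move=> a0 QQ [q [M [kappa [Munit kappa0 Mn above simplex]]]].
have hE x : height (Q^T *m n) (a *: (x *m Q) + t) =
    a * height n x + height (Q^T *m n) t.
  by rewrite heightD heightZ /height -mulmxA (mulmxA Q) QQ mul1mx.
exists (a *: (q *m Q) + t), (a *: (M *m Q)), (a * kappa); split.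
- rewrite unitmxZ ?unitfE ?gt_eqF // unitmx_mul Munit.
  by case/mulmx1_unit: QQ.
- exact: mulr_gt0.
- by rewrite -scalemxAl -mulmxA (mulmxA Q) QQ mul1mx Mn scalerA.
- by move=> _ [x Sx <-]; rewrite !hE lerD2r ler_pM2l //; exact: above.
- move=> w w0 w1; exists (q + w *m M); first exact: simplex.
  by rewrite mulmxDl scalerDr -scalemxAr mulmxA addrAC.
Qed.

(** A symmetry of the vertex set permutes the facets of its convex hull. *)
Lemma facet_normal_symmetry V n (Q : 'M[R]_3) : orthogonal_mx Q ->
  (forall x, V x -> V (x *m Q)) -> (forall x, V x -> V (x *m Q^T)) ->
  facet_normal (convex_hull V) n -> facet_normal (convex_hull V) (Q^T *m n).
Proof.
move=> QQ VQ VQT /(facet_normal_similarity 0 ltr01 QQ).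
have hullM M x : (forall x, V x -> V (x *m M)) ->
    convex_hull V x -> convex_hull V (x *m M).
  move=> VM; pose A : set E := [set y | convex_hull V (y *m M)].
  apply: (@convex_hull_sub _ V A) => [|y Vy]; last first.
    exact: sub_convex_hull (VM y Vy).
  apply/convex_setP => y z s t s0 t0 st Vy Vz.
  rewrite /A /= mulmxDl -!scalemxAl.
  by have /convex_setP := @convex_hull_convex _ V; apply.
suff -> : [set 1 *: (x *m Q) + 0 | x in convex_hull V] = convex_hull V by [].
apply/seteqP; split=> [_ [x Vx <-]|x Vx].
  by rewrite scale1r addr0; exact: hullM.
exists (x *m Q^T); first exact: hullM.
by rewrite scale1r addr0 -mulmxA (mulmx1C QQ) mulmx1.
Qed.

(** A facet recognized on vertices. Since [- q0] is a vertex too, strictly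
    inside the supporting half-space, it completes [q0], [q1], [q2] to a
    tetrahedron. *)
Lemma facet_normal_vertices V n (q0 q1 q2 : E) :
  V q0 -> V q1 -> V q2 -> V (- q0) ->
  (forall x, V x -> height n q0 <= height n x) -> height n q0 < 0 ->
  height n q1 = height n q0 -> height n q2 = height n q0 ->
  (forall u v : R, u *: (q1 - q0) + v *: (q2 - q0) = 0 -> u = 0 /\ v = 0) ->
  facet_normal (convex_hull V) n.
Proof.
move=> V0 V1 V2 Vm above neg h1 h2 free.
pose M : 'M[R]_3 := \matrix_(i < 3) nth 0 [:: q1 - q0; q2 - q0; - q0 - q0] i.
have wM w : w *m M =
    w 0 0 *: (q1 - q0) + w 0 1 *: (q2 - q0) + w 0 2 *: (- q0 - q0).
  by rewrite mulmx_sum_row sum_ord3 !rowK.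
pose kappa := - height n q0 - height n q0.
have Mn : M *m n = kappa *: delta_mx 2 0.
  apply/colP => i; have -> : (M *m n) i 0 = height n (row i M).
    by rewrite /height rowE -mulmxA -rowE [RHS]mxE.
  move: i; apply: forall_ord3;
    rewrite rowK /= heightB ?h1 ?h2 ?subrr !mxE ?mulr0 //=.
  by rewrite mulr1 -scaleN1r heightZ mulN1r.
have kappa0 : 0 < kappa by rewrite /kappa; lra.
exists q0, M, kappa; split => //.
- rewrite -row_free_unit; apply: inj_row_free => w wM0.
  have w2 : w 0 2 = 0.
    have := congr1 (fun y : E => height n y) wM0.
    rewrite {1}/height -mulmxA Mn -scalemxAr mxE mxE sum_ord3 !mxE /=.
    rewrite !mulr0 !add0r mulr1 /height mul0mx mxE => /eqP.
    by rewrite mulf_eq0 (gt_eqF kappa0) => /eqP.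
  have [w0 w1] : w 0 0 = 0 /\ w 0 1 = 0.
    by apply: free; rewrite -wM0 wM w2 scale0r addr0.
  by apply/rowP; apply: forall_ord3; rewrite mxE.
- exact: (convex_hull_sub (@convex_halfspace _ n (height n q0))).
- move=> w w0 w1; rewrite wM.
  have -> : q0 + (w 0 0 *: (q1 - q0) + w 0 1 *: (q2 - q0)
                  + w 0 2 *: (- q0 - q0)) =
      (1 - (w 0 0 + w 0 1 + w 0 2)) *: q0 + w 0 0 *: q1 + w 0 1 *: q2
      + w 0 2 *: (- q0).
    by apply/rowP => i; rewrite !mxE; ring.
  apply: (convex_comb4 (@convex_hull_convex _ V)) => //;
    try exact: sub_convex_hull.
  - by rewrite subr_gt0.
  - by ring.
Qed.

End Invariance.

(** * The hexagons and squares of the truncated cuboctahedron *)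

Section Truncated.
Context {R : realType}.
Local Notation E := 'rV[R]_3.
Local Notation c := (@truncated_cuboctahedron_coord R).
Local Notation V := (@truncated_cuboctahedron_vertices R).
Implicit Types (x y : E) (n : 'cV[R]_3).

Lemma truncated_coordE :
  (c 0 = 1) * (c 1 = 1 + Num.sqrt 2) * (c 2 = 1 + 2 * Num.sqrt 2).
Proof. by []. Qed.

Lemma coord_ge1 i : 1 <= c i.
Proof.
have r0 : 0 <= Num.sqrt 2 :> R by exact: sqrtr_ge0.
by move: i; apply: forall_ord3; rewrite truncated_coordE; lra.
Qed.

Lemma vertexP (s : 'S_3) (e0 e1 e2 : bool) :
  V (row3 ((-1) ^+ e0 * c (s 0)) ((-1) ^+ e1 * c (s 1))
          ((-1) ^+ e2 * c (s 2))).
Proof.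
exists s, (fun i => nth false [:: e0; e1; e2] i).
by apply/rowP; apply: forall_ord3; rewrite row3E mxE.
Qed.

(** What makes the supporting planes visible: the absolute values of the
    coordinates have a fixed sum, which bounds the sum of the coordinates
    (hexagon), and are at least 1, which bounds the sum of any two (square). *)
Lemma vertex_bounds x : V x -> exists d : 'I_3 -> R,
  [/\ forall i, `|x 0 i| = d i, forall i, 1 <= d i &
      d 0 + d 1 + d 2 = c 0 + c 1 + c 2].
Proof.
move=> [s [e ->]]; exists (c \o s); split=> [i|i|].
- rewrite mxE normrM normrX normrN1 expr1n mul1r ger0_norm //.
  exact: le_trans (coord_ge1 _).
- exact: coord_ge1.
- by rewrite -!sum_ord3 [RHS](reindex_inj (@perm_inj _ s)).
Qed.

Lemma facet_normal_signs (e : 'I_3 -> bool) (a b d : R) :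
  facet_normal (convex_hull V) (row3 a b d)^T ->
  facet_normal (convex_hull V)
    (row3 ((-1) ^+ e 0 * a) ((-1) ^+ e 1 * b) ((-1) ^+ e 2 * d))^T.
Proof.
pose D : 'M[R]_3 := diag_mx (\row_i (-1) ^+ e i).
have DT : D^T = D by exact: tr_diag_mx.
have VD x : V x -> V (x *m D).
  move=> [s [f ->]]; exists s, (fun i => e i (+) f i).
  by apply/rowP => i; rewrite mul_mx_diag !mxE signr_addb mulrC mulrA.
have DD : orthogonal_mx D.
  rewrite /orthogonal_mx DT mulmx_diag -[RHS]diag_const_mx; congr diag_mx.
  by apply/rowP => i; rewrite !mxE -expr2 sqrr_sign.
move=> /(@facet_normal_symmetry _ V _ D DD VD); rewrite DT => /(_ VD).
congr facet_normal; apply/colP => i; rewrite mul_diag_mx !mxE.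
by move: i; apply: forall_ord3.
Qed.

Lemma facet_normal_perm (s : 'S_3) n :
  facet_normal (convex_hull V) n -> facet_normal (convex_hull V) (row_perm s n).
Proof.
have Vperm t x : V x -> V (x *m perm_mx t).
  move=> [u [f ->]]; exists (t^-1 * u)%g, (f \o t^-1%g).
  by apply/rowP => i; rewrite -[t]invgK -col_permE invgK !mxE permM.
rewrite row_permE -[s]invgK -tr_perm_mx.
apply: facet_normal_symmetry; last first.
- by move=> x; rewrite tr_perm_mx; exact: Vperm.
- exact: Vperm.
- by rewrite /orthogonal_mx tr_perm_mx -perm_mxM mulgV perm_mx1.
Qed.

Lemma sqrt2_gt0 : 0 < Num.sqrt 2 :> R.
Proof. by rewrite sqrtr_gt0. Qed.

Lemma hexagon_normal : facet_normal (convex_hull V) (row3 (-1) (-1) (-1))^T.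
Proof.
have r0 := sqrt2_gt0.
apply: (@facet_normal_vertices _ _ _ (row3 (c 0) (c 1) (c 2))
  (row3 (c 1) (c 0) (c 2)) (row3 (c 0) (c 2) (c 1))).
- by have := vertexP 1%g false false false; rewrite !perm1 !mul1r.
- have := vertexP (tperm 0 1) false false false.
  by rewrite tpermL tpermR tpermD ?mul1r.
- have := vertexP (tperm 1 2) false false false.
  by rewrite tpermL tpermR tpermD ?mul1r.
- have := vertexP 1%g true true true; rewrite !perm1 !mulN1r; congr V.
  by apply/rowP; apply: forall_ord3; rewrite [RHS]mxE !row3E.
- move=> x /vertex_bounds[d [xd _ dsum]]; rewrite !height_row3 !row3E.
  have := ler_norm (x 0 0); have := ler_norm (x 0 1); have := ler_norm (x 0 2).
  by rewrite !xd; lra.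
- by rewrite height_row3 !row3E !truncated_coordE; lra.
- by rewrite !height_row3 !row3E; ring.
- by rewrite !height_row3 !row3E; ring.
- move=> u v /rowP uv; have := uv 2; have := uv 0.
  rewrite !mxE /= !truncated_coordE => uv0 uv2.
  have /eqP : u * Num.sqrt 2 = 0 by move: uv0; lra.
  have /eqP : v * Num.sqrt 2 = 0 by move: uv2; lra.
  by rewrite !mulf_eq0 (gt_eqF r0) !orbF => /eqP-> /eqP->.
Qed.

Lemma square_normal : facet_normal (convex_hull V) (row3 0 (-1) (-1))^T.
Proof.
have r0 := sqrt2_gt0.
apply: (@facet_normal_vertices _ _ _ (row3 (c 0) (c 1) (c 2))
  (row3 (- c 0) (c 1) (c 2)) (row3 (c 0) (c 2) (c 1))).
- by have := vertexP 1%g false false false; rewrite !perm1 !mul1r.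
- by have := vertexP 1%g true false false; rewrite !perm1 !mul1r mulN1r.
- have := vertexP (tperm 1 2) false false false.
  by rewrite tpermL tpermR tpermD ?mul1r.
- have := vertexP 1%g true true true; rewrite !perm1 !mulN1r; congr V.
  by apply/rowP; apply: forall_ord3; rewrite [RHS]mxE !row3E.
- move=> x /vertex_bounds[d [xd d1 dsum]]; rewrite !height_row3 !row3E.
  have := ler_norm (x 0 1); have := ler_norm (x 0 2); have := d1 0.
  by rewrite !xd; move: dsum; rewrite truncated_coordE; lra.
- by rewrite height_row3 !row3E !truncated_coordE; lra.
- by rewrite !height_row3 !row3E; ring.
- by rewrite !height_row3 !row3E; ring.
- move=> u v /rowP uv; have := uv 2; have := uv 0.
  rewrite !mxE /= !truncated_coordE => uv0 uv2.
  have u0 : u = 0 by move: uv0; lra.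
  have /eqP : v * Num.sqrt 2 = 0 by move: uv2; rewrite u0; lra.
  by rewrite mulf_eq0 (gt_eqF r0) orbF => /eqP->.
Qed.

Lemma hull_facet_normals n :
  n \in facet_normals -> facet_normal (convex_hull V) n.
Proof.
have sign (a b d : R) (f0 f1 f2 : bool) :
    facet_normal (convex_hull V) (row3 a b d)^T ->
    facet_normal (convex_hull V)
      (row3 (if f0 then - a else a) (if f1 then - b else b)
            (if f2 then - d else d))^T.
  move=> /(facet_normal_signs (fun i => nth false [:: f0; f1; f2] i)) /=.
  by case: f0; case: f1; case: f2; rewrite /= ?mul1r ?mulN1r.
have permE (s : 'S_3) (a b d a' b' d' : R) :
    (forall i, row3 a' b' d' 0 i = row3 a b d 0 (s i)) ->
    facet_normal (convex_hull V) (row3 a b d)^T ->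
    facet_normal (convex_hull V) (row3 a' b' d')^T.
  move=> eqs /(facet_normal_perm s); congr facet_normal.
  by apply/colP => i; rewrite [RHS]mxE eqs !mxE.
have hexagon f0 f1 f2 := sign _ _ _ f0 f1 f2 hexagon_normal.
have square0 f0 f1 f2 := sign _ _ _ f0 f1 f2 square_normal.
have /(sign _ _ _ _ _ _) square1 :
    facet_normal (convex_hull V) (row3 (-1) 0 (-1))^T.
  apply: (permE (tperm 0 1)) square_normal.
  by apply: forall_ord3; rewrite ?tpermL ?tpermR ?tpermD // !row3E.
have /(sign _ _ _ _ _ _) square2 :
    facet_normal (convex_hull V) (row3 (-1) (-1) 0)^T.
  apply: (permE (tperm 0 2)) square_normal.
  by apply: forall_ord3; rewrite ?tpermL ?tpermR ?tpermD // !row3E.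
rewrite /facet_normals !inE.
move=> /orP[/eqP ->|/orP[/eqP ->|/orP[/eqP ->|/orP[/eqP ->|/orP[/eqP ->|
  /orP[/eqP ->|/orP[/eqP ->|/orP[/eqP ->|/orP[/eqP ->|/eqP ->]]]]]]]]].
- by have := hexagon true true true; rewrite /= opprK.
- by have := hexagon true true false; rewrite /= opprK.
- by have := hexagon true false true; rewrite /= opprK.
- by have := hexagon true false false; rewrite /= opprK.
- by have := square2 true true false; rewrite /= opprK.
- by have := square2 true false false; rewrite /= opprK.
- by have := square1 true false true; rewrite /= opprK.
- by have := square1 true false false; rewrite /= opprK.
- by have := square0 false true true; rewrite /= opprK.
- by have := square0 false true false; rewrite /= opprK.
Qed.
End Truncated.

(** * Three axes against ten normals *)

Theorem theorem6p4 (R : realType) (P : set 'rV[R]_3) :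
  is_truncated_cuboctahedron P -> ~ orthogonally_decomposable P.
Proof.
move=> [a [Q0 [t [a0 orthQ0 ->]]]] [Q [orthQ _] [k [p [dec conn]]]].
(* The rows of [U] are the coordinate axes of the rotated copy, expressed in
   the frame of the vertices of the solid. *)
pose U := Q^T *m Q0^T.
have killed n : n \in facet_normals -> exists j, height n (row j U) = 0.
  move=> /hull_facet_normals /(facet_normal_similarity t a0 orthQ0).
  move=> /(facet_normal_similarity 0 ltr01 orthQ).
  under eq_imagel do rewrite scale1r addr0.
  by move=> facet; have [j nj] := facet_normal_zero_coord facet dec conn;
    exists j; rewrite -nj /height rowE -mulmxA -rowE mxE mulmxA.
have rowU j : row j U != 0.
  have Uunit : U \in unitmx.
    rewrite unitmx_mul !unitmx_tr; have [-> _] := mulmx1_unit orthQ.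
    by have [-> _] := mulmx1_unit orthQ0.
  apply/negP => /eqP; rewrite rowE => /(congr1 (mulmx^~ (invmx U))).
  by rewrite mulmxK // mul0mx => /rowP/(_ j)/eqP; rewrite !mxE !eqxx oner_eq0.
have : (\sum_(n <- @facet_normals R) 1 <= \sum_(j < 3) 3)%N.
  apply: (@leq_trans (\sum_(n <- facet_normals) \sum_(j < 3)
      (height n (row j U) == 0)%R)).
    rewrite big_seq [leqRHS]big_seq; apply: leq_sum => n /killed[j nj].
    by rewrite (bigD1 j) //= nj eqxx.
  by rewrite exchange_big; apply: leq_sum => j _; exact: orthogonal_normals_le3.
by rewrite !big_cons big_nil sum_nat_const card_ord.
Qed.
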